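(* Let $N_\mathrm{t},N_\mathrm{r}\ge1$ and let $\mathbf{H}\in\mathbb{C}^{N_\mathrm{r}\times N_\mathrm{t}}$ have i.i.d. entries distributed as $\mathcal{CN}(0,1)$. Let $\check{\mathbf{x}}_k,\check{\mathbf{x}}_{k'}\in\{-1,+1\}^{N_\mathrm{t}}$ (BPSK labels) differ in exactly $d$ coordinates, $1\le d\le N_\mathrm{t}$, and set $\mathbf{g}_k=\mathbf{H}\check{\mathbf{x}}_k$, $\mathbf{g}_{k'}=\mathbf{H}\check{\mathbf{x}}_{k'}$. Then $$\mathbb{P}\big[\operatorname{sign}(\mathbf{g}_k)=\operatorname{sign}(\mathbf{g}_{k'})\big]=\left[\frac{2}{\pi}\arctan\sqrt{\frac{N_\mathrm{t}-d}{d}}\right]^{2N_\mathrm{r}}.$$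
   Context: For real $a$, $\operatorname{sign}(a)=+1$ if $a\ge0$ and $-1$ if $a<0$; for complex $a$, $\operatorname{sign}(a)=\operatorname{sign}(\Re\{a\})+j\operatorname{sign}(\Im\{a\})$; on vectors it acts element-wise. *)

(* Defs.v *)
From HB Require Import structures.
From mathcomp Require Import all_boot all_order all_algebra.
From mathcomp Require Import all_classical all_reals all_analysis.
From mathcomp Require Import complex.
Set Implicit Arguments. Unset Strict Implicit. Unset Printing Implicit Defensive.
Import Order.TTheory GRing.Theory Num.Theory.
Local Open Scope classical_set_scope.
Local Open Scope ring_scope.

Definition rsign {R : realType} (a : R) : R := if 0 <= a then 1 else -1.

Definition csign {R : realType} (a : R[i]) : R[i] :=
  ((rsign (complex.Re a)) +i* (rsign (complex.Im a)))%C.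

Definition msign {R : realType} (m n : nat) (A : 'M[R[i]]_(m, n)) :
  'M[R[i]]_(m, n) := map_mx csign A.

(* Mutual independence of a finite family of real random variables:
   the joint law factorizes on all measurable rectangles. (For a finite
   index set, allowing B i = setT covers every finite subfamily.) *)
Definition mutually_independent {d : measure_display} {T : measurableType d}
  {R : realType} (P : probability T R) (I : finType) (X : I -> {RV P >-> R}) :=
  forall B : I -> set R, (forall i, measurable (B i)) ->
    P (\bigcap_(i in [set: I]) (X i @^-1` B i)) =
    (\prod_(i : I) P (X i @^-1` B i))%E.

Definition cmatrix {d : measure_display} {T : measurableType d}
  {R : realType} (P : probability T R) (Nr Nt : nat)
  (Hre Him : 'I_Nr -> 'I_Nt -> {RV P >-> R}) (w : T) : 'M[R[i]]_(Nr, Nt) :=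
  \matrix_(i, j) ((Hre i j w) +i* (Him i j w))%C.

(* Main.v *)
(** Split the columns into those where the two labels agree and those where they
    differ, and let [U] and [V] be the corresponding partial sums of a real (or
    imaginary) row of [H] weighted by the first label.  Then the two received
    values are [U + V] and [U - V], where [U] and [V] are independent centered
    Gaussians of variances [(Nt - d) / 2] and [d / 2].  Up to a null set they have
    the same sign iff [|V| <= |U|].  Substituting [v = u w] in the inner integral
    and exchanging the integrals turns the probability of that event into
    [\int_(-1)^1 a b / (pi (b^2 + a^2 w^2)) dw = 2 / pi * atan (a / b)], with
    [a] and [b] the two standard deviations.  The [2 Nr] real rows are
    independent, hence the power.

    Independence is handled through lists of random variables: two members of an
    independent list may be replaced by a measurable function of them, and every
    grouping of the entries of [H] is obtained by iterating this step. *)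
Require Import Defs.
From HB Require Import structures.
From mathcomp Require Import all_boot all_order all_algebra.
From mathcomp Require Import all_classical all_reals all_analysis measurable_realfun.
From mathcomp Require Import complex.
From mathcomp Require Import ring lra.
Import Order.TTheory GRing.Theory Num.Theory.
Import numFieldNormedType.Exports.
Local Open Scope classical_set_scope.
Local Open Scope ring_scope.

(** * Normal distributions *)

Section normal.
Context {R : realType}.
Implicit Types (a b c m s u v w x z : R) (A : set R).
Local Notation mu := (@lebesgue_measure R).

(** The Radon-Nikodym derivative of [normal_prob m s] agrees almost everywhere with
    [normal_pdf m s], since both integrate to the same value over every measurable set. *)
Lemma integral_normal_prob m s (f : R -> \bar R) :
  (normal_prob m s).-integrable setT f ->
  (\int[normal_prob m s]_x f x = \int[mu]_x (f x * (normal_pdf m s x)%:E))%E.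
Proof.
move=> fi; have mf := measurable_int _ fi.
have dom := @normal_prob_dominates R m s.
rewrite -(Radon_Nikodym_change_of_variables dom)//.
have mpdf : measurable_fun [set: R] (fun x => (normal_pdf m s x)%:E).
  by apply/measurable_EFinP; exact: measurable_normal_pdf.
apply: ae_eq_integral => //.
- exact: emeasurable_funM.
- exact: emeasurable_funM.
apply: ae_eqe_mul2l; rewrite Radon_NikodymE.
case: cid => /= h [h1 h2 h3].
by apply: integral_ae_eq => //= E _ mE; rewrite -h3.
Qed.

(** * Translation, reflection and convolution of normal laws *)

Lemma measurable_addl c : measurable_fun setT
  (fun x : measurableTypeR R => c + x : measurableTypeR R).
Proof. exact: measurable_funD. Qed.

(** Lebesgue measure is determined by the lengths of half-open intervals, and a translation
    preserves these. *)
Lemma lebesgue_measureD c A : measurable A ->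
  pushforward mu (fun x : measurableTypeR R => c + x : measurableTypeR R) A =
  mu A.
Proof.
move=> mA; apply/esym.
have mc := measurable_addl c.
pose nu := pushforward mu (fun x : measurableTypeR R => c + x : measurableTypeR R)
  : {measure set (measurableTypeR R) -> \bar R}.
apply: (@lebesgue_measure_unique _ (nu mc)) => //= _ [[a b]] _ <-.
rewrite /nu /= /pushforward/= (_ : _ @^-1` _ = `]a - c, b - c]%classic); last first.
  by apply/seteqP; split => x /=; rewrite !in_itv/= ltrBlDl lerBrDl.
rewrite !lebesgue_measure_itv/= !lte_fin ltrD2r -!EFinB.
by case: ifP => // _; congr EFin; ring.
Qed.

Lemma ge0_integral_translation c (f : R -> \bar R) A : measurable A ->
  measurable_fun setT f -> (forall x, 0 <= f x)%E ->
  (\int[mu]_(x in [set x | A (c + x)%R]) f (c + x)%R = \int[mu]_(x in A) f x)%E.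
Proof.
move=> mA mf f0.
have mc := measurable_addl c.
transitivity (\int[pushforward mu (fun x : measurableTypeR R =>
    (c + x)%R : measurableTypeR R)]_(x in A) f x)%E.
  by rewrite (ge0_integral_pushforward mc)//; exact: measurable_funTS.
by apply: eq_measure_integral => //= B mB _; exact: lebesgue_measureD.
Qed.

Lemma normal_pdf_shift m s c x : s != 0 ->
  normal_pdf m s (x - c) = normal_pdf (m + c) s x.
Proof. by move=> s0; rewrite !normal_pdfE// /normal_fun opprD addrA addrAC. Qed.

Lemma normal_prob_shift m s c A : s != 0 -> measurable A ->
  normal_prob m s [set x | A (c + x)] = normal_prob (m + c) s A.
Proof.
move=> s0 mA; rewrite /normal_prob.
rewrite -(@ge0_integral_translation c (EFin \o normal_pdf (m + c) s))//.
- apply: eq_integral => x _ /=.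
  by rewrite -normal_pdf_shift// (addrC c) addrK.
- by apply/measurable_EFinP; exact: measurable_normal_pdf.
- by move=> x; rewrite lee_fin normal_pdf_ge0.
Qed.

Lemma measurable_normal_pdf2 s : s != 0 ->
  measurable_fun setT (fun p : R * R => normal_pdf p.1 s p.2).
Proof.
move=> s0.
under eq_fun do rewrite -[X in normal_pdf X](add0r _.1) -normal_pdf_shift//.
apply: (measurableT_comp (measurable_normal_pdf 0 s)).
by apply: measurable_funB.
Qed.

(** Completing the square in [x]. The left side is the joint density of the first summand [x] and
    the sum [z]; the right side is the density of the sum times the conditional density of the first
    summand given the sum. *)
Lemma normal_pdfM s1 s2 x z : 0 < s1 -> 0 < s2 ->
  let s := Num.sqrt (s1 ^+ 2 + s2 ^+ 2) in
  normal_pdf 0 s1 x * normal_pdf x s2 z =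
  normal_pdf 0 s z * normal_pdf (s1 ^+ 2 / s ^+ 2 * z) (s1 * s2 / s) x.
Proof.
move=> s10 s20 s.
have sq : s ^+ 2 = s1 ^+ 2 + s2 ^+ 2 by rewrite sqr_sqrtr// addr_ge0 ?sqr_ge0.
have s0 : 0 < s by rewrite sqrtr_gt0 addr_gt0 ?exprn_gt0.
have s'0 : 0 < s1 * s2 / s by rewrite divr_gt0 ?mulr_gt0.
rewrite !normal_pdfE ?gt_eqF// /normal_fun mulrACA [RHS]mulrACA.
rewrite -!expRD; congr (_ * expR _).
  have peak_ge0 t : 0 <= t ^+ 2 * pi *+ 2 :> R.
    by rewrite mulrn_wge0// mulr_ge0 ?sqr_ge0 ?pi_ge0.
  rewrite /normal_peak -!invfM -!sqrtrM//.
  congr (Num.sqrt _)^-1; field.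
  by rewrite gt_eqF.
rewrite !expr_div_n !exprMn sq; field.
by rewrite !gt_eqF// -?sq ?exprn_gt0.
Qed.

Lemma normal_probN s (A : set R) : s != 0 -> measurable A ->
  normal_prob 0 s [set x | A (- x)] = normal_prob 0 s A.
Proof.
move=> s0 mA; rewrite /normal_prob.
transitivity (\int[pushforward mu (-%R : measurableTypeR R -> measurableTypeR R)]_(x in A)
    (normal_pdf 0 s x)%:E)%E; last first.
  by apply: eq_measure_integral => //= B mB _; exact: lebesgue_measureN.
rewrite ge0_integral_pushforward//=.
- by apply: eq_integral => x _ /=; rewrite !normal_pdfE// /normal_fun !subr0 sqrrN.
- by apply/measurable_funTS/measurable_EFinP; exact: measurable_normal_pdf.
- by move=> x _; rewrite lee_fin normal_pdf_ge0.
Qed.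

Lemma product_normal_probE m1 s1 m2 s2
    (X : set (measurableTypeR R * measurableTypeR R)) : measurable X ->
  ((normal_prob m1 s1 \x normal_prob m2 s2) X =
   \int[mu]_x (normal_prob m2 s2 (xsection X x) * (normal_pdf m1 s1 x)%:E))%E.
Proof.
move=> mX; rewrite /product_measure1 /= integral_normal_prob//.
apply: (@le_integrable _ _ _ _ _ _ _ (cst 1%E)) => //.
- exact: measurable_fun_xsection.
- move=> x _ /=; rewrite gee0_abs// normr1.
  by apply: probability_le1; exact: measurable_xsection.
- exact: (finite_measure_integrable_cst (normal_prob m1 s1) 1).
Qed.

Lemma lebesgue_tonelli (f : R -> R -> R) :
  measurable_fun setT (fun p : R * R => f p.1 p.2) ->
  (forall x y, 0 <= f x y) ->
  (\int[mu]_x \int[mu]_y (f x y)%:E = \int[mu]_y \int[mu]_x (f x y)%:E)%E.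
Proof.
move=> mf f0; apply: (@fubini_tonelli _ _ (measurableTypeR R) (measurableTypeR R)
  R mu mu (fun p => (f p.1 p.2)%:E)).
  exact/measurable_EFinP.
by move=> p; rewrite lee_fin.
Qed.

Lemma normal_prob_convolution s1 s2 A : 0 < s1 -> 0 < s2 -> measurable A ->
  ((normal_prob 0 s1 \x normal_prob 0 s2)%E
    [set p : measurableTypeR R * measurableTypeR R | A (p.1 + p.2)]) =
  normal_prob 0 (Num.sqrt (s1 ^+ 2 + s2 ^+ 2)) A.
Proof.
move=> s10 s20 mA; set s := Num.sqrt _; set X := [set _ | _].
have mX : measurable X.
  have mD : measurable_fun setT (fun p : R * R => p.1 + p.2).
    exact: measurable_funD.
  by rewrite -[X]setTI; exact: mD.
rewrite product_normal_probE//.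
have mpdf2 : measurable_fun setT (fun p : R * R => normal_pdf p.1 s2 p.2).
  by apply: measurable_normal_pdf2; rewrite gt_eqF.
have mpdf t : measurable_fun [set: R] (normal_pdf 0 t).
  exact: measurable_normal_pdf.
have mindic : measurable_fun setT (\1_A : R -> R) by exact: measurable_indic.
(* Passing from the second summand to the sum [z] makes the section equal to [A] for every [x] and
   moves the mean of the inner density to [x]. *)
transitivity (\int[mu]_x \int[mu]_z
    (\1_A z * (normal_pdf 0 s1 x * normal_pdf x s2 z))%:E)%E.
  apply: eq_integral => x _.
  rewrite (_ : xsection X x = [set z | A (x + z)]); last first.
    by apply/seteqP; split => z /=; rewrite /xsection/= inE.
  rewrite normal_prob_shift ?gt_eqF// add0r /normal_prob integral_mkcond.
  rewrite -ge0_integralZr//=.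
  - apply: eq_integral => z _; rewrite patchE indicE; case: ifP => _.
      by rewrite mul1r -EFinM mulrC.
    by rewrite mul0r mul0e.
  - apply/(measurable_restrictT _ _).1 => //.
    apply/measurable_EFinP/measurable_funTS.
    exact: measurable_normal_pdf.
  - by move=> z _; rewrite patchE; case: ifP => // _; rewrite lee_fin normal_pdf_ge0.
  - by rewrite lee_fin normal_pdf_ge0.
(* With the order exchanged, the inner integral in [x] is that of a conditional density, hence 1;
   the density of the sum remains. *)
rewrite (lebesgue_tonelli
  (fun x z => \1_A z * (normal_pdf 0 s1 x * normal_pdf x s2 z)))/=.
- rewrite /normal_prob [RHS]integral_mkcond; apply: eq_integral => z _.
  under eq_integral do rewrite normal_pdfM// mulrA EFinM.
  rewrite ge0_integralZl//=.
  + rewrite integral_normal_pdf mule1 patchE indicE; case: ifP => _.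
      by rewrite mul1r.
    by rewrite mul0r.
  + by apply/measurable_EFinP; exact: measurable_normal_pdf.
  + by move=> x _; rewrite lee_fin normal_pdf_ge0.
  + by rewrite lee_fin mulr_ge0// normal_pdf_ge0.
- apply: measurable_funM => //=.
    exact: (measurableT_comp mindic).
  apply: measurable_funM => //.
  exact: (measurableT_comp (mpdf _)).
- by move=> x z; rewrite !mulr_ge0 ?normal_pdf_ge0.
Qed.

(** * The ratio of two independent centered Gaussians *)

Lemma integral_abs_gauss (c : R) : 0 < c ->
  (\int[mu]_u (`|u| * expR (- c * u ^+ 2))%:E)%E = c^-1%:E.
Proof.
move=> c0.
have cf : continuous (fun u : R => `|u| * expR (- c * u ^+ 2)).
  move=> x; apply: cvgM; first exact: norm_continuous.
  apply: continuous_comp; last exact: continuous_expR.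
  by apply: cvgMl_tmp; exact: exprn_continuous.
rewrite ge0_symfun_integralT//; last first.
  by move=> x/=; rewrite normrN sqrrN.
rewrite (_ : [set x | _] = `[0, +oo[%classic); last first.
  by apply/seteqP; split => x/=; rewrite in_itv/= andbT.
pose F (u : R) : R := - (2 * c)^-1 * expR (- c * u ^+ 2).
have dF (x : R) : is_derive x (1 : R) F (x * expR (- c * x ^+ 2)).
  rewrite /F; apply: is_derive_eq.
  rewrite /GRing.scale/=.
  by field; rewrite gt_eqF.
rewrite (_ : (\int[mu]_(x in `[0%R, +oo[) (`|x| * expR (- c * x ^+ 2))%:E)%E =
  (\int[mu]_(x in `[0%R, +oo[) (x * expR (- c * x ^+ 2))%:E)%E); last first.
  by apply: eq_integral => x; rewrite inE/= in_itv/= andbT => x0; rewrite ger0_norm.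
rewrite (@ge0_continuous_FTC2y _ _ F 0 0).
- rewrite -EFinB -EFinM /F expr0n/= mulr0 expR0 mulr1; congr EFin.
  by field; rewrite gt_eqF.
- by move=> x x0; rewrite mulr_ge0// expR_ge0.
- apply: continuous_subspaceT => x.
  apply: cvgM; first exact: cvg_id.
  apply: continuous_comp; last exact: continuous_expR.
  by apply: cvgMl_tmp; exact: exprn_continuous.
- rewrite /F -[X in _ --> X](mulr0 (- (2 * c)^-1)); apply: cvgMl_tmp.
  under eq_fun do rewrite mulNr.
  apply: (cvg_comp (fun x => c * x ^+ 2) (fun x => expR (- x)));
    last exact: cvgr_expR.
  apply: gt0_cvgMry => //.
  exact: cvgr_expr2.
- by move=> x _; apply: ex_derive.
- apply: cvg_at_right_filter; apply: differentiable_continuous.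
  by apply/derivable1_diffP; apply: ex_derive.
- by move=> x _; rewrite derive1E; apply: derive_val.
Qed.

Lemma normal_peakE s : 0 < s -> normal_peak s = (s * Num.sqrt (pi *+ 2))^-1 :> R.
Proof.
move=> s0; rewrite /normal_peak -mulrnAr sqrtrM ?sqr_ge0//.
by rewrite sqrtr_sqr gtr0_norm.
Qed.

(** This is the density at [w] of the ratio [V / U], a Cauchy law of scale [b / a]. The two
    exponents combine into [- c * u ^+ 2], which reduces the claim to [integral_abs_gauss]. *)
Lemma integral_abs_normal_pdf2 a b w : 0 < a -> 0 < b ->
  (\int[mu]_u (normal_pdf 0 a u * (`|u| * normal_pdf 0 b (w * u)))%:E =
   (a * b / (pi * (b ^+ 2 + a ^+ 2 * w ^+ 2)))%:E)%E.
Proof.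
move=> a0 b0; pose c := (a ^+ 2 *+ 2)^-1 + w ^+ 2 / (b ^+ 2 *+ 2).
have c0 : 0 < c.
  rewrite ltr_pwDl ?invr_gt0 ?mulrn_wgt0 ?exprn_gt0//.
  by rewrite divr_ge0 ?mulrn_wge0 ?sqr_ge0.
pose K : R := normal_peak a * normal_peak b.
transitivity (\int[mu]_u (K%:E * (`|u| * expR (- c * u ^+ 2))%:E))%E.
  apply: eq_integral => u _; rewrite -EFinM; congr EFin.
  rewrite !normal_pdfE ?gt_eqF// /normal_fun !subr0.
  rewrite (_ : - c * _ = - u ^+ 2 / (a ^+ 2 *+ 2) + - (w * u) ^+ 2 / (b ^+ 2 *+ 2)).
    by rewrite expRD /K; ring.
  by rewrite /c; field; rewrite !gt_eqF.
rewrite ge0_integralZl//=; last 2 first.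
- apply/measurable_EFinP; apply: measurable_funM; first exact: normr_measurable.
  apply: measurableT_comp => //.
  by apply: measurable_funM => //; exact: measurable_funX.
- by rewrite lee_fin mulr_ge0 ?normal_peak_ge0.
rewrite integral_abs_gauss// -EFinM; congr EFin.
rewrite /K !normal_peakE// -invfM mulrACA -expr2 sqr_sqrtr; last first.
  by apply: mulrn_wge0; exact: pi_ge0.
rewrite -invfM.
have ab0 : b ^+ 2 + a ^+ 2 * w ^+ 2 != 0.
  by rewrite gt_eqF// ltr_pwDl ?exprn_gt0// mulr_ge0 ?sqr_ge0.
rewrite (_ : c = (b ^+ 2 + a ^+ 2 * w ^+ 2) / (a ^+ 2 * b ^+ 2 *+ 2)); last first.
  by rewrite /c; field; rewrite !gt_eqF.
have := pi_gt0 R; move: ab0; move: (_ + _) pi => q p q0 p0.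
by field; rewrite q0 !gt_eqF.
Qed.

(** Substitution [v = w * |u|], which is increasing for [u != 0] and maps the fixed interval onto
    the one depending on [u]. Evenness of the density then replaces [w * |u|] by [w * u]. *)
Lemma integral_normal_pdf_itv b u : b != 0 ->
  (\int[mu]_(v in `[(- `|u|)%R, `|u|%R]) (normal_pdf 0 b v)%:E =
   \int[mu]_(w in `[(-1)%R, 1%R]) (`|u| * normal_pdf 0 b (w * u))%:E)%E.
Proof.
move=> b0; have pdfN v : normal_pdf 0 b (- v) = normal_pdf 0 b v.
  by rewrite !normal_pdfE// /normal_fun !subr0 sqrrN.
have [->|u0] := eqVneq u 0.
  rewrite normr0 oppr0 set_itv1 integral_set1.
  by under eq_integral do rewrite mul0r; rewrite integral0.
pose F (w : R) : R := w * `|u|.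
have derF : F^`()%classic = cst `|u|.
  by apply/funext => z; rewrite derive1Mr// derive1_id mul1r.
have cF : continuous F by move=> z; apply: cvgMr_tmp; exact: cvg_id.
have FN1 : F (-1) = - `|u| by rewrite /F mulN1r.
have F1 : F 1 = `|u| by rewrite /F mul1r.
have N11 : -1 <= 1 :> R by lra.
have := @integration_by_substitution_increasing R F (normal_pdf 0 b) _ _ N11.
rewrite FN1 F1 => ->.
- apply: eq_integral => w _; rewrite derF fctE/= mulrC; congr (_ * _)%:E.
  rewrite /F /=; have [u_ge0|u_lt0] := leP 0 u.
    by rewrite ger0_norm.
  by rewrite ltr0_norm// mulrN pdfN.
- by move=> x y _ _ xy; rewrite /F ltr_pM2r// normr_gt0.
- by rewrite derF => z _; exact: cvg_cst.
- by rewrite derF; exact: is_cvg_cst.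
- by rewrite derF; exact: is_cvg_cst.
- split.
  + by move=> x _; apply: derivableM.
  + by apply: cvg_at_right_filter; exact: cF.
  + by apply: cvg_at_left_filter; exact: cF.
- by apply: continuous_subspaceT; exact: continuous_normal_pdf.
Qed.

Lemma integral_atan_itv a b : 0 < a -> 0 < b ->
  (\int[mu]_(w in `[(-1)%R, 1%R]) (a * b / (pi * (b ^+ 2 + a ^+ 2 * w ^+ 2)))%:E =
   (2 / pi * atan (a / b))%:E)%E.
Proof.
move=> a0 b0; have := pi_gt0 R; move: pi => p p0.
pose F (w : R) : R := p^-1 * atan (a / b * w).
have ab0 w : 0 < b ^+ 2 + a ^+ 2 * w ^+ 2.
  by rewrite ltr_pwDl ?exprn_gt0// mulr_ge0 ?sqr_ge0.
have dF (w : R) : is_derive w (1 : R) F (a * b / (p * (b ^+ 2 + a ^+ 2 * w ^+ 2))).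
  rewrite /F; apply: is_derive_eq.
  rewrite /GRing.scale/=; field.
  by rewrite exprMn !gt_eqF.
have cF : continuous F.
  move=> x; apply: differentiable_continuous.
  by apply/derivable1_diffP; apply: ex_derive.
rewrite (@continuous_FTC2 _ _ F).
- rewrite -EFinB /F mulrN1 atanN mulr1; congr EFin; field.
  by rewrite gt_eqF.
- by lra.
- apply: continuous_subspaceT => x; apply: cvgMl_tmp; apply: cvgV.
    by rewrite mulf_neq0 ?gt_eqF.
  apply: cvgMl_tmp; apply: cvgD; first exact: cvg_cst.
  by apply: cvgMl_tmp; exact: exprn_continuous.
- split.
  + by move=> x _; apply: ex_derive.
  + by apply: cvg_at_right_filter; exact: cF.
  + by apply: cvg_at_left_filter; exact: cF.
- by move=> x _; rewrite derive1E; apply: derive_val.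
Qed.

(** * The event that the sum and the difference have equal signs *)

Lemma measurable_rsign : measurable_fun [set: R] (@rsign R).
Proof.
apply: measurable_fun_ifT => //.
exact: measurable_fun_ler.
Qed.

Lemma measurable_rsignDB :
  measurable [set p : measurableTypeR R * measurableTypeR R |
     rsign (p.1 + p.2 : R) = rsign (p.1 - p.2 : R)].
Proof.
have mD : measurable_fun setT (fun p : R * R => rsign (p.1 + p.2)).
  by apply: (measurableT_comp measurable_rsign); exact: measurable_funD.
have mB : measurable_fun setT (fun p : R * R => rsign (p.1 - p.2)).
  by apply: (measurableT_comp measurable_rsign); exact: measurable_funB.
have := measurable_fun_eqr mD mB => /(_ measurableT [set true] I).
by rewrite setTI; congr measurable; apply/seteqP; split => p /=; move/eqP.
Qed.

Lemma rsign_eqP u v :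
  rsign u = rsign v <-> (0 <= u) && (0 <= v) || (u < 0) && (v < 0).
Proof.
rewrite /rsign; case: leP => u0; case: leP => v0 //=; split => //; lra.
Qed.

Lemma normal_prob_rsignDB b u : b != 0 ->
  (normal_prob 0 b [set v | rsign (u + v) = rsign (u - v)] =
   \int[mu]_(v in `[(- `|u|)%R, `|u|%R]) (normal_pdf 0 b v)%:E)%E.
Proof.
move=> b0; rewrite /normal_prob.
have mpdf D : measurable_fun D (fun v : R => (normal_pdf 0 b v)%:E).
  by apply/measurable_funTS/measurable_EFinP; exact: measurable_normal_pdf.
have [u0|u0] := leP 0 u.
  rewrite ger0_norm//; congr (integral _ _ _); apply/seteqP; split => v /=.
    by move/rsign_eqP; rewrite in_itv/=; lra.
  by rewrite in_itv/= => uv; apply/rsign_eqP; lra.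
(* For [u < 0] both signs must be negative, because [rsign 0 = 1]; the event is thus the open
   interval, and the two endpoints carry no mass. *)
rewrite ltr0_norm// opprK (integral_itv_bndoo true false)//.
congr (integral _ _ _); apply/seteqP; split => v /=.
  by move/rsign_eqP; rewrite in_itv/=; lra.
by rewrite in_itv/= => uv; apply/rsign_eqP; lra.
Qed.

Lemma normal_prob2_rsignDB a b : 0 < a -> 0 < b ->
  (normal_prob 0 a \x normal_prob 0 b)%E
    [set p : measurableTypeR R * measurableTypeR R |
     rsign (p.1 + p.2 : R) = rsign (p.1 - p.2 : R)] = (2 / pi * atan (a / b))%:E.
Proof.
move=> a0 b0.
have b0' : b != 0 by rewrite gt_eqF.
rewrite product_normal_probE; last exact: measurable_rsignDB.
have mpdf t : measurable_fun [set: R] (normal_pdf 0 t).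
  exact: measurable_normal_pdf.
(* After the substitution the range of [w] no longer depends on [u], so the integrals can be
   exchanged; the inner one becomes the Cauchy density, integrated over [[-1, 1]]. *)
transitivity (\int[mu]_u \int[mu]_w
    (\1_`[(-1)%R, 1%R] w *
     (normal_pdf 0 a u * (`|u| * normal_pdf 0 b (w * u))))%:E)%E.
  apply: eq_integral => u _.
  rewrite (_ : xsection _ u = [set v | rsign (u + v) = rsign (u - v)]); last first.
    by apply/seteqP; split => z /=; rewrite /xsection/= inE.
  rewrite normal_prob_rsignDB// integral_normal_pdf_itv// integral_mkcond.
  rewrite -ge0_integralZr//=.
  - apply: eq_integral => z _; rewrite patchE indicE; case: ifP => _.
      by rewrite mul1r -EFinM mulrC.
    by rewrite mul0r mul0e.
  - apply/(measurable_restrictT _ _).1 => //.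
    apply/measurable_EFinP/measurable_funTS.
    apply: measurable_funM => //; apply: (measurableT_comp (mpdf b)).
    exact: measurable_funM.
  - move=> z _; rewrite patchE; case: ifP => // _.
    by rewrite lee_fin mulr_ge0// normal_pdf_ge0.
  - by rewrite lee_fin normal_pdf_ge0.
rewrite (lebesgue_tonelli (fun u w => \1_`[(-1)%R, 1%R] w *
  (normal_pdf 0 a u * (`|u| * normal_pdf 0 b (w * u)))))/=.
- rewrite -integral_atan_itv// [RHS]integral_mkcond; apply: eq_integral => w _.
  under eq_integral do rewrite EFinM.
  rewrite ge0_integralZl//=.
  + rewrite integral_abs_normal_pdf2// patchE indicE; case: ifP => _.
      by rewrite mul1e.
    by rewrite mul0e.
  + apply/measurable_EFinP; apply: measurable_funM; first exact: mpdf.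
    apply: measurable_funM; first exact: normr_measurable.
    apply: (measurableT_comp (mpdf b)); exact: measurable_funM.
  + by move=> x _; rewrite lee_fin !mulr_ge0// normal_pdf_ge0.
- apply: measurable_funM => //=.
    by apply: (measurableT_comp (measurable_indic _)).
  apply: measurable_funM => //.
    exact: (measurableT_comp (mpdf _)).
  apply: measurable_funM.
    exact: measurableT_comp.
  apply: (measurableT_comp (mpdf b)); exact: measurable_funM.
- by move=> x z; rewrite !mulr_ge0 ?normal_pdf_ge0.
Qed.

End normal.

(** * Independence *)

(** Bundling the measurability proof lets a list pair each variable with an admissible set. *)
Definition borel_set (R : realType) := {B : set R | measurable B}.

Section independence.
Context {d : measure_display} {T : measurableType d} {R : realType}.
Context (P : probability T R).
Implicit Types (f g : {mfun T >-> R}) (l : seq {mfun T >-> R}).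

(** Rectangles are stable under intersection and generate the product sigma-algebra, so two finite
    measures agreeing on them are equal. The event [E] keeps track of the remaining variables when
    [f] and [g] are grouped. *)
Lemma probability_pair_restr f g (E : set T) : measurable E ->
  (forall A B : set R, measurable A -> measurable B ->
    P (f @^-1` A `&` (g @^-1` B `&` E)) = P (f @^-1` A) * P (g @^-1` B) * P E)%E ->
  forall X : set (R * R), measurable X ->
  (P ([set w | X (f w, g w)] `&` E) =
   (distribution P f \x distribution P g) X * P E)%E.
Proof.
move=> mE fgE X mX.
have c0 : 0 <= fine (P E) by rewrite fine_ge0.
have mfg : measurable_fun setT (fun w => (f w, g w)) by exact: measurable_fun_pair.
pose m1 := mscale (NngNum c0) (distribution P f \x distribution P g)%E.
pose m2' := pushforward (mrestr P mE) (fun w => (f w, g w))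
  : {measure set (R * R) -> \bar R}.
pose m2 := m2' mfg.
suff : m2 X = m1 X.
  rewrite /m2 /m1 /= /pushforward /mrestr /mscale /= fineK ?fin_num_measure//.
  by rewrite muleC.
pose C : set (set (R * R)) :=
  [set A `*` B | A in (@measurable _ R) & B in (@measurable _ R)].
apply: (@measure_unique _ _ _ C (fun=> setT)) => //.
- by rewrite measurable_prod_measurableType.
- move=> /= _ _ [X1 mX1 [X2 mX2 <-]] [Y1 mY1 [Y2 mY2 <-]].
  rewrite -setXI; exists (X1 `&` Y1); first exact: measurableI.
  by exists (X2 `&` Y2) => //; exact: measurableI.
- by move=> _; exists setT => //; exists setT => //; rewrite setXTT.
- by rewrite bigcup_const.
- move=> _ [A mA [B mB <-]].
  rewrite /m2 /m1 /= /pushforward /mrestr /mscale /= fineK ?fin_num_measure//.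
  rewrite product_measure1E//= muleC -fgE// setIA; congr (P (_ `&` _)).
- move=> _; rewrite /m2 /= /pushforward /mrestr/= preimage_setT setTI.
  by rewrite -ge0_fin_numE ?fin_num_measure.
Qed.

(* The sets are indexed by the positions of the list, so repetitions are allowed. *)
Definition independent_seq l := forall r : seq ({mfun T >-> R} * borel_set R),
  map fst r = l ->
  P (\big[setI/setT]_(p <- r) (p.1 @^-1` sval p.2)) =
  (\prod_(p <- r) P (p.1 @^-1` sval p.2))%E.

Lemma measurable_cylinder (r : seq ({mfun T >-> R} * borel_set R)) :
  measurable (\big[setI/setT]_(p <- r) (p.1 @^-1` sval p.2)).
Proof.
apply: big_ind => //; first by move=> ? ?; exact: measurableI.
by move=> [f [B mB]] _ /=; exact: measurable_funPTI.
Qed.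

(** Intersections and products commute. Rotations are what brings any block to the head of the list,
    where replacements take place. *)
Lemma independent_seq_rot l1 l2 :
  independent_seq (l1 ++ l2) -> independent_seq (l2 ++ l1).
Proof.
move=> ind r rE; pose r2 := take (size l2) r; pose r1 := drop (size l2) r.
have -> : r = r2 ++ r1 by rewrite cat_take_drop.
have r1E : map fst r1 = l1 by rewrite map_drop rE drop_size_cat.
have r2E : map fst r2 = l2 by rewrite map_take rE take_size_cat.
have := ind (r1 ++ r2); rewrite map_cat r1E r2E => /(_ erefl).
by rewrite !big_cat/= setIC muleC.
Qed.

Lemma independent_seq_catl l1 l2 :
  independent_seq (l1 ++ l2) -> independent_seq l1.
Proof.
(* The variables of [l2] are given the whole space, which changes neither the intersection nor the
   product. *)
move=> ind r rE; pose mT : borel_set R := exist _ setT measurableT.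
have := ind (r ++ [seq (f, mT) | f <- l2]).
rewrite map_cat rE -map_comp map_id => /(_ erefl).
rewrite !big_cat !big_map/=.
rewrite [X in _ `&` X]big1// setIT [X in (_ * X)%E]big1 ?mule1// => f _.
by rewrite preimage_setT probability_setT.
Qed.

Lemma independent_seq_flatten_mem (K : eqType) (block : K -> seq {mfun T >-> R})
    (k : K) (ks : seq K) :
  k \in ks -> independent_seq (flatten [seq block k | k <- ks]) ->
  independent_seq (block k).
Proof.
elim: ks => [//|k' ks IH]; rewrite inE /= => /predU1P[<-|kks].
  exact: independent_seq_catl.
by move=> /independent_seq_rot/independent_seq_catl; exact: IH.
Qed.

(** Every preimage under a constant is either the whole space or empty. This covers the empty
    sum. *)
Lemma independent_seq_cst0 l f : (forall w, f w = 0) ->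
  independent_seq l -> independent_seq (f :: l).
Proof.
move=> f0 ind [//|[g B] r] /= [-> rE]; rewrite !big_cons/=.
have [B0|B0] := pselect (sval B 0).
- rewrite (_ : f @^-1` _ = setT).
    by rewrite setTI probability_setT mul1e ind.
  by apply/seteqP; split => // w _ /=; rewrite f0.
- rewrite (_ : f @^-1` _ = set0).
    by rewrite set0I measure0 mul0e.
  by apply/seteqP; split => // w /=; rewrite f0.
Qed.

Lemma independent_seq2 f g l : independent_seq (f :: g :: l) ->
  forall X : set (R * R), measurable X ->
  (P [set w | X (f w, g w)] = (distribution P f \x distribution P g) X)%E.
Proof.
move=> ind X mX; rewrite -[LHS](@congr1 _ _ P _ _ (setIT _)).
rewrite probability_pair_restr// ?probability_setT ?mule1// => A B mA mB.
have := @independent_seq_catl [:: f; g] l ind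
  [:: (f, exist _ A mA); (g, exist _ B mB)] erefl.
by rewrite !big_cons !big_nil/= mule1 mule1.
Qed.

(** An event on [Z] is an event on the pair [(f, g)], so [probability_pair_restr] applies with [E]
    the cylinder over the other variables. *)
Lemma independent_seq_merge f g l (Z : {mfun T >-> R}) (h : R * R -> R) :
  measurable_fun setT h -> (forall w, Z w = h (f w, g w)) ->
  independent_seq (f :: g :: l) -> independent_seq (Z :: l).
Proof.
move=> mh Zh ind [//|[_ B] r] /= [-> rE]; rewrite !big_cons/=.
have mX : measurable (h @^-1` sval B).
  by rewrite -[_ @^-1` _]setTI; apply: mh => //; case: B.
rewrite (_ : Z @^-1` _ = [set w | (h @^-1` sval B) (f w, g w)]); last first.
  by apply/seteqP; split => w /=; rewrite Zh.
rewrite (independent_seq2 _ _ _ ind)//.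
have indr (A A' : borel_set R) :
  P (f @^-1` sval A `&` (g @^-1` sval A' `&`
     \big[setI/setT]_(p <- r) (p.1 @^-1` sval p.2))) =
  (P (f @^-1` sval A) *
   (P (g @^-1` sval A') * \prod_(p <- r) P (p.1 @^-1` sval p.2)))%E.
  by have := ind [:: (f, A), (g, A') & r]; rewrite /= rE !big_cons; exact.
have PE : P (\big[setI/setT]_(p <- r) (p.1 @^-1` sval p.2)) =
    (\prod_(p <- r) P (p.1 @^-1` sval p.2))%E.
  pose mT : borel_set R := exist _ setT measurableT.
  by have := indr mT mT; rewrite /= !preimage_setT !setTI probability_setT !mul1e.
rewrite probability_pair_restr//; first by rewrite PE.
- exact: measurable_cylinder.
- move=> A A' mA mA'; rewrite PE -muleA.
  exact: (indr (exist _ A mA) (exist _ A' mA')).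
Qed.

End independence.

(** * From independent families to independent lists *)

Section mutually_independent_seq.
Context {d : measure_display} {T : measurableType d} {R : realType}.
Context (P : probability T R).

Lemma mutually_independent_seq (I : finType) (X : I -> {RV P >-> R})
    (Y : I -> {mfun T >-> R})    (phi : I -> R -> R) (s : seq I) :
  @mutually_independent _ _ _ P _ X ->
  (forall i, measurable_fun setT (phi i)) -> (forall i w, Y i w = phi i (X i w)) ->
  uniq s -> (forall i, i \in s) -> independent_seq P [seq Y i | i <- s].
Proof.
move=> ind mphi YX us sT r rE.
pose mT : borel_set R := exist _ setT (@measurableT _ R).
(* The Borel set that [r] attaches to the position of [i] in [s]; as [s] has no repetition and
   exhausts [I], this recovers all of [r], and the default is never reached. *)
pose b i := (nth (Y i, mT) r (index i s)).2.
have sz : size r = size s by rewrite -(size_map fst) rE size_map.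
have rY : r = [seq (Y i, b i) | i <- s].
  case: s us sT rE @b sz => [|i0 s] us sT rE b sz; first exact: size0nil.
  apply: (@eq_from_nth _ (Y i0, mT)); first by rewrite size_map.
  move=> k; rewrite sz => ks; rewrite (nth_map i0)// /b index_uniq//.
  rewrite [LHS]surjective_pairing; congr pair; last first.
    by congr snd; apply: set_nth_default; rewrite sz.
  by rewrite -(nth_map _ (Y i0) fst) ?sz// rE (nth_map i0).
have YB i (B : set R) : Y i @^-1` B = X i @^-1` (phi i @^-1` B).
  by apply/seteqP; split => w /=; rewrite YX.
rewrite rY !big_map/=.
have ps : perm_eq s (index_enum I).
  apply: uniq_perm => //; first exact: index_enum_uniq.
  by move=> i; rewrite sT mem_index_enum.
have := ind (fun i => phi i @^-1` sval (b i)) => /(_ _)/wrap[].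
  by move=> i; rewrite -[_ @^-1` _]setTI; apply: mphi => //; case: (b i).
under [X in _ = X -> _]eq_bigr do rewrite -YB.
rewrite (perm_big _ ps)/= [in X in _ -> _ = X](perm_big _ ps)/= => <-.
congr (P _); rewrite -bigcap_seq; apply/seteqP; split => w wE i /=.
  by move=> _; rewrite -YX; apply: wE => /=; rewrite mem_index_enum.
by move=> _; rewrite YX; exact: wE.
Qed.

End mutually_independent_seq.

(** * Replacing whole blocks of an independent list *)

Section reduction.
Context {d : measure_display} {T : measurableType d} {R : realType}.
Context (P : probability T R).
Implicit Types (f g Z : {mfun T >-> R}) (l : seq {mfun T >-> R}).

(** Quantifying over the remaining list [l'] makes such replacements composable inside a larger
    independent list. *)
Definition reduces_to l Z := forall l',
  independent_seq P (l ++ l') -> independent_seq P (Z :: l').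

Lemma independent_seq_pair l1 l2 l' Z1 Z2 :
  reduces_to l1 Z1 -> reduces_to l2 Z2 ->
  independent_seq P (l1 ++ l2 ++ l') -> independent_seq P (Z1 :: Z2 :: l').
Proof.
move=> r1 r2 /r1; rewrite -[Z1 :: _]/([:: Z1] ++ _) => /independent_seq_rot.
rewrite -catA => /r2; rewrite -[Z2 :: _]/([:: Z2] ++ _) catA => /independent_seq_rot.
by [].
Qed.

Lemma reduces_to_cat l1 l2 Z1 Z2 Z (h : R * R -> R) :
  measurable_fun setT h -> (forall w, Z w = h (Z1 w, Z2 w)) ->
  reduces_to l1 Z1 -> reduces_to l2 Z2 -> reduces_to (l1 ++ l2) Z.
Proof.
move=> mh Zh r1 r2 l'; rewrite -catA => /(independent_seq_pair _ _ _ _ _ r1 r2).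
exact: (@independent_seq_merge _ _ _ _ _ _ _ _ h).
Qed.

Lemma independent_seq_flatten (K : Type) (block : K -> seq {mfun T >-> R})
    (Z : K -> {mfun T >-> R}) (ks : seq K) l' :
  (forall k, reduces_to (block k) (Z k)) ->
  independent_seq P (flatten [seq block k | k <- ks] ++ l') ->
  independent_seq P ([seq Z k | k <- ks] ++ l').
Proof.
move=> red; elim: ks l' => [//|k ks IH] l' /=; rewrite -catA => /red.
rewrite -[Z k :: _]/([:: Z k] ++ _) => /independent_seq_rot.
rewrite -catA => /IH; rewrite catA => /independent_seq_rot.
by [].
Qed.

Fixpoint list_mfun_sum l : {mfun T >-> R} :=
  if l is f :: l' then f \+ list_mfun_sum l' else cst 0.

Lemma list_mfun_sumE l w : list_mfun_sum l w = \sum_(f <- l) f w.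
Proof. by elim: l => [|f l IH]; rewrite ?big_nil// big_cons -IH. Qed.

Lemma reduces_to_sum l : reduces_to l (list_mfun_sum l).
Proof.
elim: l => [|f l IH] /=; first by move=> l'; exact: independent_seq_cst0.
apply: (@reduces_to_cat [:: f] l f (list_mfun_sum l) _ (fun p => p.1 + p.2)) => //.
exact: measurable_funD.
Qed.

End reduction.

(** * Sums of independent Gaussians *)

Section gaussian.
Context {d : measure_display} {T : measurableType d} {R : realType}.
Context (P : probability T R).
Implicit Types (f g : {mfun T >-> R}) (s : R).

Definition centered_normal f s := forall A : set R, measurable A ->
  P (f @^-1` A) = normal_prob 0 s A.

Lemma centered_normal_sign f g s (e : R) : s != 0 -> e = 1 \/ e = -1 ->
  (forall w, g w = e * f w) -> centered_normal f s -> centered_normal g s.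
Proof.
move=> s0 e1 gf fs A mA; case: e1 => e1.
  rewrite -fs//; congr (P _); apply/seteqP.
  by split => w /=; rewrite gf e1 mul1r.
rewrite -normal_probN// -fs.
  congr (P _); apply/seteqP.
  by split => w /=; rewrite gf e1 mulN1r.
rewrite -[X in measurable X]setTI.
by apply: (@measurable_funN _ _ _ setT id).
Qed.

Lemma independent_normal2 f g s1 s2 :
  independent_seq P [:: f; g] -> centered_normal f s1 -> centered_normal g s2 ->
  forall X : set (measurableTypeR R * measurableTypeR R), measurable X ->
  (P [set w | X (f w, g w)] = (normal_prob 0 s1 \x normal_prob 0 s2) X)%E.
Proof.
move=> ind fs gs X mX.
have mf : measurable_fun setT (f : T -> measurableTypeR R).
  exact: (@measurable_funPT _ _ T R f).
have mg : measurable_fun setT (g : T -> measurableTypeR R).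
  exact: (@measurable_funPT _ _ T R g).
have mfg := measurable_fun_pair mf mg.
pose m := pushforward P (fun w => (f w : measurableTypeR R, g w : measurableTypeR R))
  : {measure set (measurableTypeR R * measurableTypeR R) -> \bar R}.
rewrite (@product_measure_unique _ _ _ _ _ _ _ (m mfg))// => A B mA mB.
have := ind [:: (f, exist _ (A : set R) mA); (g, exist _ (B : set R) mB)] erefl.
by rewrite !big_cons !big_nil/= mule1 setIT fs// gs.
Qed.

Lemma centered_normal_sum (J : Type) (Y : J -> {mfun T >-> R}) s (js : seq J) :
  0 < s -> (forall j, centered_normal (Y j) s) -> (0 < size js)%N ->
  independent_seq P [seq Y j | j <- js] ->
  centered_normal (list_mfun_sum [seq Y j | j <- js]) (s * Num.sqrt (size js)%:R).
Proof.
move=> s0 Ys; elim: js => [//|j js IH] _ ind.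
(* The induction starts from a single summand: an empty sum would have standard deviation 0, which
   the convolution lemma excludes. *)
have [js0|js0] := posnP (size js).
  move=> A mA; rewrite (size0nil js0)/= sqrtr1 mulr1 -(Ys j)//.
  by congr (P _); apply/seteqP; split => w /=; rewrite addr0.
have indjs : independent_seq P [seq Y j | j <- js].
  by move: ind => /(independent_seq_rot _ [:: _])/independent_seq_catl.
have ind2 : independent_seq P [:: Y j; list_mfun_sum [seq Y j | j <- js]].
  apply: (@independent_seq_pair _ _ _ _ [:: Y j] [seq Y j | j <- js] [::]).
  - by [].
  - exact: reduces_to_sum.
  - by rewrite cats0.
move=> A mA.
pose X := [set p : measurableTypeR R * measurableTypeR R | A (p.1 + p.2)].
have mX : measurable X.
  have mD : measurable_fun setT (fun p : R * R => p.1 + p.2).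
    exact: measurable_funD.
  by rewrite -[X]setTI; exact: mD.
have sjs0 : 0 < s * Num.sqrt (size js)%:R by rewrite mulr_gt0 ?sqrtr_gt0 ?ltr0n.
rewrite [LHS](independent_normal2 _ _ _ _ ind2 (Ys j) (IH js0 indjs) X mX).
rewrite normal_prob_convolution//; congr (normal_prob _ _ _).
rewrite exprMn sqr_sqrtr// -[X in X + _]mulr1 -mulrDr.
by rewrite sqrtrM ?sqr_ge0// sqrtr_sqr gtr0_norm//= -natr1 addrC.
Qed.

Lemma probability_rsignDB (J : Type) (Y : J -> {mfun T >-> R}) s (js1 js2 : seq J) :
  0 < s -> (forall j, centered_normal (Y j) s) -> (0 < size js2)%N ->
  independent_seq P ([seq Y j | j <- js1] ++ [seq Y j | j <- js2]) ->
  let U := list_mfun_sum [seq Y j | j <- js1] in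
  let V := list_mfun_sum [seq Y j | j <- js2] in
  P [set w | rsign (U w + V w) = rsign (U w - V w)] =
  (2 / pi * atan (Num.sqrt ((size js1)%:R / (size js2)%:R)))%:E.
Proof.
move=> s0 Ys js20 ind U V.
have indV : independent_seq P [seq Y j | j <- js2].
  by move: ind => /independent_seq_rot/independent_seq_catl.
have VN := centered_normal_sum _ _ _ _ s0 Ys js20 indV.
(* If the labels agree nowhere then [U = 0], and [V] and [- V] have the same sign only at [V = 0], a
   null event, matching [atan 0 = 0]. *)
have [js10|js10] := posnP (size js1).
  rewrite js10 mul0r sqrtr0 atan0 mulr0 (_ : [set w | _] = V @^-1` [set 0]).
    rewrite VN//; exact: integral_set1.
  apply/seteqP; rewrite /U (size0nil js10) /=; split => w /=; last first.
    by move=> ->; rewrite oppr0.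
  by rewrite add0r sub0r => /rsign_eqP; lra.
have UN := centered_normal_sum _ _ _ _ s0 Ys js10 (independent_seq_catl _ _ _ ind).
have ind2 : independent_seq P [:: U; V].
  apply: (@independent_seq_pair _ _ _ _ _ _ [::]); try exact: reduces_to_sum.
  by rewrite cats0.
rewrite (independent_normal2 _ _ _ _ ind2 UN VN
  [set p | rsign (p.1 + p.2 : R) = rsign (p.1 - p.2 : R)]);
  last exact: measurable_rsignDB.
rewrite normal_prob2_rsignDB ?mulr_gt0 ?sqrtr_gt0 ?ltr0n//.
(* The common factor [s] cancels in the ratio of the standard deviations. *)
by rewrite invfM mulrACA divff ?gt_eqF// mul1r sqrtrM// sqrtrV.
Qed.

Definition mfun_comp2 {h : R * R -> R} (mh : measurable_fun setT h) f g :
    {mfun T >-> R} :=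
  HB.pack (fun w => h (f w, g w)) (isMeasurableFun.Build _ _ _ _ _
    (measurableT_comp mh (measurable_fun_pair
      (@measurable_funPT _ _ _ _ f) (@measurable_funPT _ _ _ _ g)))).

End gaussian.

(** * Splitting the received vectors into real rows *)

Section rows.
Context {R : realType}.

Lemma csign_eqP (a b : R[i]) : csign a = csign b <->
  rsign (complex.Re a) = rsign (complex.Re b) /\
  rsign (complex.Im a) = rsign (complex.Im b).
Proof. by rewrite /csign; split => [[-> ->]//|[-> ->]]. Qed.

Lemma Re_sum (I : Type) (r : seq I) (F : I -> R[i]) :
  complex.Re (\sum_(i <- r) F i) = \sum_(i <- r) complex.Re (F i).
Proof. exact: raddf_sum. Qed.

Lemma Im_sum (I : Type) (r : seq I) (F : I -> R[i]) :
  complex.Im (\sum_(i <- r) F i) = \sum_(i <- r) complex.Im (F i).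
Proof. exact: raddf_sum. Qed.

Context {d : measure_display} {T : measurableType d} (P : probability T R).
Context {Nr Nt : nat} (Hre Him : 'I_Nr -> 'I_Nt -> {RV P >-> R}).

Let entry (p : 'I_Nr * 'I_Nt * bool) :=
  if p.2 then Hre p.1.1 p.1.2 else Him p.1.1 p.1.2.

(** Real labels do not mix real and imaginary parts, so each complex row yields two real rows; the
    boolean in [k] selects the real part when true. *)
Lemma msign_mulmx_eqP (x y : 'I_Nt -> R) (xk yk : 'cV[R[i]]_Nt) (w : T) :
  (forall j, xk j 0 = (x j)%:C%C) -> (forall j, yk j 0 = (y j)%:C%C) ->
  msign (cmatrix Hre Him w *m xk) = msign (cmatrix Hre Him w *m yk) <->
  forall k : 'I_Nr * bool,
    rsign (\sum_j x j * entry (k.1, j, k.2) w) =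
    rsign (\sum_j y j * entry (k.1, j, k.2) w).
Proof.
move=> xE yE.
have rowE (z : 'I_Nt -> R) (zk : 'cV[R[i]]_Nt)
    (zE : forall j, zk j 0 = (z j)%:C%C) i :
    (complex.Re ((cmatrix Hre Him w *m zk) i 0) =
       \sum_j z j * entry (i, j, true) w) *
    (complex.Im ((cmatrix Hre Him w *m zk) i 0) =
       \sum_j z j * entry (i, j, false) w).
  rewrite !mxE Re_sum Im_sum; split; apply: eq_bigr => j _.
    by rewrite !mxE zE/= /entry/= mulr0 subr0 mulrC.
  by rewrite !mxE zE/= /entry/= mulr0 add0r mulrC.
split=> [/matrixP eqm [i b]|eqr].
  have := eqm i 0; rewrite [LHS]mxE [RHS]mxE => /csign_eqP.
  by rewrite !(rowE x xk xE) !(rowE y yk yE)//=; case: b => -[].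
apply/matrixP => i j; rewrite (ord1 j) [LHS]mxE [RHS]mxE; apply/csign_eqP.
rewrite !(rowE x xk xE) !(rowE y yk yE).
by split; [exact: (eqr (i, true))|exact: (eqr (i, false))].
Qed.

End rows.

Theorem theorem1 (R : realType) (dT : measure_display) (T : measurableType dT)
  (P : probability T R) (Nt Nr : nat) (hNt : (1 <= Nt)%N) (hNr : (1 <= Nr)%N)
  (Hre Him : 'I_Nr -> 'I_Nt -> {RV P >-> R})
  (hindep : mutually_independent
     (fun p : 'I_Nr * 'I_Nt * bool =>
        if p.2 then Hre p.1.1 p.1.2 else Him p.1.1 p.1.2))
  (hgauss : forall (i : 'I_Nr) (j : 'I_Nt) (A : set R), measurable A ->
     distribution P (Hre i j) A = normal_prob 0 (Num.sqrt (2^-1)) A /\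
     distribution P (Him i j) A = normal_prob 0 (Num.sqrt (2^-1)) A)
  (xk xk' : 'cV[R[i]]_Nt)
  (hxk : forall j : 'I_Nt, xk j 0 = 1 \/ xk j 0 = -1)
  (hxk' : forall j : 'I_Nt, xk' j 0 = 1 \/ xk' j 0 = -1)
  (d : nat) (hd1 : (1 <= d)%N) (hdN : (d <= Nt)%N)
  (hd : #|[pred j : 'I_Nt | xk j 0 != xk' j 0]| = d) :
  P [set w | msign (cmatrix Hre Him w *m xk) = msign (cmatrix Hre Him w *m xk')]
  = (((2 / pi) * atan (Num.sqrt ((Nt - d)%:R / d%:R))) ^+ (2 * Nr))%:E.
Proof.
set s := Num.sqrt _ in hgauss; have s0 : 0 < s by rewrite sqrtr_gt0 invr_gt0.
pose x j := complex.Re (xk j 0); pose x' j := complex.Re (xk' j 0).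
have x1 j : x j = 1 \/ x j = -1.
  by rewrite /x; case: (hxk j) => ->; [left|right].
have xE j : xk j 0 = (x j)%:C%C.
  rewrite /x; case: (hxk j) => -> /=; apply/eqP.
    by rewrite eq_complex/= !eqxx.
  by rewrite eq_complex/= oppr0 !eqxx.
have x'E j : xk' j 0 = (x' j)%:C%C.
  rewrite /x'; case: (hxk' j) => -> /=; apply/eqP.
    by rewrite eq_complex/= !eqxx.
  by rewrite eq_complex/= oppr0 !eqxx.
(* Two labels in [{-1, 1}] that differ are opposite. *)
have xx' j : x' j = if xk j 0 == xk' j 0 then x j else - x j.
  rewrite /x /x'; case: eqP => [->//|].
  case: (hxk j) => ->; case: (hxk' j) => -> //= _.
  by rewrite opprK.
pose X (p : 'I_Nr * 'I_Nt * bool) :=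
  if p.2 then Hre p.1.1 p.1.2 else Him p.1.1 p.1.2.
have XN p : centered_normal P (X p) s.
  move=> A mA; case: p => [[i j] []]; rewrite /X/=.
    by have [] := hgauss i j A mA.
  by have [] := hgauss i j A mA.
(* Each entry is weighted by the first label, a sign, which leaves its law unchanged. *)
pose phi (p : 'I_Nr * 'I_Nt * bool) (t : R) := x p.1.2 * t.
have mphi p : measurable_fun [set: R] (phi p) by exact: measurable_funM.
have mscal p : measurable_fun setT (fun q : R * R => phi p q.1).
  by apply: (measurableT_comp (mphi p)).
pose Y p := mfun_comp2 (mscal p) (X p) (X p).
have YN p : centered_normal P (Y p) s.
  apply: (@centered_normal_sign _ _ _ _ (X p) _ _ (x p.1.2)) => //.
  by rewrite gt_eqF.
pose js1 := enum [pred j | xk j 0 == xk' j 0].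
pose js2 := enum [pred j | xk j 0 != xk' j 0].
have sz2 : size js2 = d by rewrite -cardE.
have sz1 : size js1 = (Nt - d)%N.
  have := cardC [pred j | xk j 0 == xk' j 0]; rewrite card_ord.
  rewrite [X in (_ + X)%N](_ : _ = d); last by rewrite -hd; apply: eq_card.
  by rewrite -cardE => /(congr1 (subn^~ d)); rewrite addnK.
pose Yrow (k : 'I_Nr * bool) j := Y (k.1, j, k.2).
pose U k := list_mfun_sum [seq Yrow k j | j <- js1].
pose V k := list_mfun_sum [seq Yrow k j | j <- js2].
(* The indicator of the equal-sign event turns the event of each real row into a random variable
   [Z k], so independence of the rows becomes independence of a list. *)
have mh : measurable_fun setT (fun p : R * R =>
    (\1_[set q : R * R | rsign (q.1 + q.2) = rsign (q.1 - q.2)] p : R)).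
  by apply: measurable_indic; exact: measurable_rsignDB.
pose Z k := mfun_comp2 mh (U k) (V k).
pose block k := [seq Yrow k j | j <- js1] ++ [seq Yrow k j | j <- js2].
pose ks := enum {: 'I_Nr * bool}.
have indY : independent_seq P (flatten [seq block k | k <- ks]).
  (* An enumeration of all real entries, one real row after another, with the agreeing columns first
     in each row. *)
  pose sI := [seq (k.1, j, k.2) | k <- ks, j <- js1 ++ js2].
  have -> : flatten [seq block k | k <- ks] = [seq Y p | p <- sI].
    rewrite map_allpairs; congr flatten; apply: eq_map => k.
    by rewrite map_cat.
  have js12 j : j \in js1 ++ js2.
    by rewrite mem_cat !mem_enum !inE orbN.
  apply: (mutually_independent_seq P _ _ Y phi sI hindep) => //.
  - apply: allpairs_uniq; first exact: enum_uniq.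
    + rewrite cat_uniq !enum_uniq /= andbT; apply/hasPn => j.
      by rewrite !mem_enum !inE.
    + by move=> [[i b] j] [[i' b'] j'] _ _ /= [-> -> ->].
  - move=> [[i j] b]; apply/allpairsP; exists ((i, b), j).
    by split => //; rewrite mem_enum.
have indZ : independent_seq P [seq Z k | k <- ks].
  rewrite -[X in independent_seq P X]cats0.
  apply: (@independent_seq_flatten _ _ _ _ _ block).
    move=> k; apply: (@reduces_to_cat _ _ _ _ _ _ (U k) (V k) _ _ mh) => //;
      exact: reduces_to_sum.
  by rewrite cats0.
have Zset k : Z k @^-1` [set 1] =
    [set w | rsign (U k w + V k w) = rsign (U k w - V k w)].
  apply/seteqP; split => w /=; rewrite indicE.
    case: (boolP (_ \in _)) => [/set_mem//|_] /eqP.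
    by rewrite eq_sym oner_eq0.
  by move=> eqw; rewrite mem_set.
have PZ k : P (Z k @^-1` [set 1]) =
    (2 / pi * atan (Num.sqrt ((Nt - d)%:R / d%:R)))%:E.
  rewrite Zset (@probability_rsignDB _ _ _ _ _ (Yrow k) s js1 js2) ?sz1 ?sz2//.
    by move=> j; exact: YN.
  apply: (@independent_seq_flatten_mem _ _ _ _ _ block k ks _ indY).
  by rewrite mem_enum.
have UV k w : (U k w + V k w = \sum_j x j * X (k.1, j, k.2) w) *
              (U k w - V k w = \sum_j x' j * X (k.1, j, k.2) w).
  rewrite /U /V !list_mfun_sumE !big_map/= !big_enum/=.
  split; rewrite [RHS](bigID (fun j => xk j 0 == xk' j 0))//=; congr +%R.
    by apply: eq_bigr => j; rewrite inE xx' => ->.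
  rewrite -sumrN; apply: eq_bigr => j.
  by rewrite inE xx' => /negbTE->; rewrite mulNr.
(* The sign vectors are equal exactly when every [Z k] is 1; the [Nr * 2] equal factors then give
   the power. *)
pose r := [seq (Z k, exist _ [set 1 : R] (measurable_set1 1) : borel_set R)
          | k <- ks].
have rE : map fst r = [seq Z k | k <- ks] by rewrite -map_comp.
rewrite (_ : [set w | _] = \big[setI/setT]_(p <- r) (p.1 @^-1` sval p.2)).
  rewrite indZ// big_map/=; under eq_bigr do rewrite PZ.
  rewrite big_const_seq count_predT -cardE card_prod card_ord card_bool mulnC.
  by elim: (2 * Nr)%N => [//|n IH]; rewrite iterS IH exprS EFinM.
rewrite big_map -bigcap_seq/=; apply/seteqP; split => w /=.
  move=> /(msign_mulmx_eqP _ _ _ _ _ _ _ _ xE x'E) eqw k _.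
  by rewrite Zset/= !UV; exact: eqw.
move=> eqw; apply/(msign_mulmx_eqP _ _ _ _ _ _ _ _ xE x'E) => k.
by rewrite -!UV; have := eqw k; rewrite Zset/= mem_enum; exact.
Qed.
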